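(* Let $\mathbb{V}=(V_1,\dots,V_n)$ be an $n$-tuple of commuting shifts on a Hilbert space $\mathcal{H}$ and suppose that the dimension of $Z(\operatorname{Ann}(\mathbb{V}))$ is $1$. Then the following assertions are equivalent. (1) There is a finite cyclic set for $\mathbb{V}$. (2) $V_i$ has finite multiplicity for each $i\in\{1,\dots,n\}$. (3) $V_i$ has finite multiplicity for at least one $i\in\{1,\dots,n\}$.
   Context: Hilbert spaces are complex. An operator $V$ on $\mathcal{H}$ is a shift if it is an isometry with $\bigcap_{j=0}^\infty V^j\mathcal{H}=\{0\}$; its multiplicity is $\dim\ker V^*$. $\operatorname{Ann}(\mathbb{V})=\{p\in\mathbb{C}[X_1,\dots,X_n]:p(V_1,\dots,V_n)=0\}$; for a set $S$ of polynomials, $Z(S)\subseteq\mathbb{C}^n$ is the common zero set, with dimension as a complex algebraic variety. A subset $S\subseteq\mathcal{H}$ is cyclic for $\mathbb{V}$ if $\{p(\mathbb{V})h:p\in\mathbb{C}[X_1,\dots,X_n],\,h\in S\}$ has dense linear span in $\mathcal{H}$. *)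

(* Defs.v *)
(* The notations of [mpoly] clash with those of MathComp-Analysis; only {mpoly
   K[n]} is restored below. *)
From mathcomp Require Export all_boot all_order all_algebra.
From mathcomp Require Export complex.
From mathcomp Require Export all_classical all_reals all_analysis.
From mathcomp Require Export -(notations) mpoly.

Set Implicit Arguments.
Unset Strict Implicit.
Unset Printing Implicit Defensive.

Export Order.TTheory GRing.Theory Num.Theory.
Export numFieldNormedType.Exports.

Global Open Scope classical_set_scope.
Global Open Scope ring_scope.

Notation "{ 'mpoly' K [ n ] }" := (mpoly.mpoly n K).

Section Zariski.
Context {K : fieldType} {n : nat}.
Implicit Types (P : set {mpoly K[n]}) (X A B : set ('I_n -> K)).

Definition zero_set P : set ('I_n -> K) :=
  [set z | forall p, P p -> mpoly.meval z p = 0].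

Definition zariski_closed X := exists P, X = zero_set P.

Definition zariski_irreducible X :=
  X !=set0 /\
  forall A B, zariski_closed A -> zariski_closed B ->
    X `<=` A `|` B -> X `<=` A \/ X `<=` B.

Definition irreducible_chain X (d : nat) (Y : 'I_d.+1 -> set ('I_n -> K)) :=
  (forall i, [/\ zariski_closed (Y i), zariski_irreducible (Y i) & Y i `<=` X])
  /\ (forall i j : 'I_d.+1, (i < j)%N -> Y i `<` Y j).

(* Krull dimension of a closed set, for the Zariski topology; no [d] satisfies
   this when X is empty. *)
Definition variety_dim X (d : nat) :=
  (exists Y : 'I_d.+1 -> set ('I_n -> K), irreducible_chain X Y) /\
  (forall e (Y : 'I_e.+1 -> set ('I_n -> K)),
     irreducible_chain X Y -> (e <= d)%N).

End Zariski.

Section Operators.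
Context {R : realType} {H : completeNormedModType R[i]}.
Implicit Types (f : {linear H -> H}) (E : set H).

(* H, with its norm, is a Hilbert space for [dot] (linear in the first
   variable); completeness is part of the type of H. *)
Definition hilbert_dot (dot : {dot H for Num.conj}) :=
  forall x : H, `|x| ^+ 2 = dot x x.

Definition lspan E : set H :=
  [set v | exists (k : nat) (c : 'I_k -> R[i]) (e : 'I_k -> H),
    (forall i, E (e i)) /\ v = \sum_(i < k) c i *: e i].

Definition finite_dimensional (A : set H) :=
  exists E, finite_set E /\ A = lspan E.

(* If [hilbert_dot dot] and f is bounded, this set is a singleton by the Riesz
   representation theorem. *)
Definition adjoint (dot : {dot H for Num.conj}) f (y : H) : H :=
  get [set z | forall x, dot (f x) y = dot x z].

Definition is_shift f :=
  (forall x, `|f x| = `|x|) /\ \bigcap_j range (iter j f) = [set 0].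

Definition finite_multiplicity (dot : {dot H for Num.conj}) f :=
  finite_dimensional [set y | adjoint dot f y = 0].

Context {n : nat}.
Implicit Types (V : 'I_n -> {linear H -> H}) (p : {mpoly R[i][n]}).

Definition commuting V := forall i j x, V i (V j x) = V j (V i x).

(* V_0 ^ m_0 \o ... \o V_(n-1) ^ m_(n-1); the order of the factors is
   immaterial when V is commuting. *)
Definition monomial_op V (m : mpoly.multinom n) : H -> H :=
  \big[(fun g h : H -> H => g \o h)/id]_(i < n) iter (m i) (V i).

Definition mpoly_op V p (h : H) : H :=
  \sum_(m <- mpoly.msupp p) mpoly.mcoeff m p *: monomial_op V m h.

Definition Ann V : set {mpoly R[i][n]} :=
  [set p | forall h, mpoly_op V p h = 0].

Definition cyclic_set V (S : set H) :=
  dense (lspan [set v | exists p h, S h /\ v = mpoly_op V p h]).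

End Operators.

(* Main.v *)
Require Import Defs.
From HB Require Import structures.
From mathcomp Require Import ring.
From mathcomp Require Import ssrcomplements.
Import -(notations) mpoly.

(** If V_i has finite multiplicity, a finite set spanning the kernel of its
    adjoint is cyclic already for V_i, by the Wold decomposition
    ([wandering_dense]). So finite multiplicity of one of the shifts gives a
    finite cyclic set. There is at least one shift because the zero set has a
    chain of length one.

    The substance is that a finite cyclic set forces all multiplicities to be
    finite. The kernel of the adjoint of V_i is the orthogonal complement of
    V_i H. The polynomials p with p(V) H contained in V_i H form an ideal J. As
    p(V) applied to a finite set spans a dense subspace, it suffices that every
    polynomial is congruent modulo J to one of bounded degree
    ([cyclic_finite_multiplicity]), and for this it suffices that each X_j
    satisfies a nonzero one-variable equation modulo J
    ([algebraic_generators_bounded]). The dimension hypothesis provides a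
    nonzero f with f(V_i, V_j) = 0. Since V_i is injective, f may be divided by
    X_i until f(0, X_j) is nonzero, and then f(0, X_j) belongs to J
    ([annihilator_to_range_ideal]).

    The existence of f is algebraic geometry: if X_i and X_j are algebraically
    independent modulo an ideal I, then the zero set of I contains a chain of
    three irreducible closed sets ([independent_pair_chain]). Indeed, I extends
    to a prime P2 containing no nonzero polynomial in X_i and X_j; for a
    suitable constant c, P2 and X_i - c lie in a prime P1 containing no nonzero
    polynomial in X_j; and the chain is a point of Z(P1), then Z(P1), then
    Z(P2). The Nullstellensatz shows that these are irreducible and distinct.

    Both the Nullstellensatz and the choice of c exploit that the complex
    numbers are uncountable while the polynomial ring has countable dimension.
    If each X_i - c were invertible, in the appropriate sense, the inverses
    would be linearly dependent, and clearing denominators would give a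
    nontrivial algebraic relation for X_i ([resolvent_relation]). *)

Set Implicit Arguments.
Unset Strict Implicit.
Unset Printing Implicit Defensive.

Local Notation "'x_ i" := (mpolyX _ (mnm1 i)) (at level 8, i at level 2).

(** * Prime ideals avoiding a multiplicative set *)

Section Ideals.
Context {A : comNzRingType}.
Implicit Types (I P S : set A).

Definition is_ideal I :=
  [/\ I 0, forall p q, I p -> I q -> I (p + q) & forall a p, I p -> I (a * p)].

Lemma idealB I p q : is_ideal I -> I p -> I q -> I (p - q).
Proof.
by case=> _ ID IM Ip Iq; rewrite -mulN1r; apply: ID => //; apply: IM.
Qed.

Lemma ideal_sum I (J : Type) (r : seq J) (F : J -> A) :
  is_ideal I -> (forall j, I (F j)) -> I (\sum_(j <- r) F j).
Proof. by case=> I0 ID _ IF; apply: big_ind. Qed.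

Definition adjoin_ideal I (f : A) : set A :=
  [set p | exists2 a, I a & exists g, p = a + g * f].

Lemma adjoin_ideal_ideal I f : is_ideal I -> is_ideal (adjoin_ideal I f).
Proof.
move=> [I0 ID IM]; split.
- by exists 0 => //; exists 0; rewrite mul0r addr0.
- move=> _ _ [a Ia [g ->]] [b Ib [h ->]]; exists (a + b); first exact: ID.
  by exists (g + h); rewrite mulrDl addrACA.
- move=> c _ [a Ia [g ->]]; exists (c * a); first exact: IM.
  by exists (c * g); rewrite mulrDr mulrA.
Qed.

Lemma sub_adjoin_ideal I f : I `<=` adjoin_ideal I f.
Proof. by move=> a Ia; exists a => //; exists 0; rewrite mul0r addr0. Qed.

Lemma mem_adjoin_ideal I f : is_ideal I -> adjoin_ideal I f f.
Proof. by case=> I0 _ _; exists 0 => //; exists 1; rewrite mul1r add0r. Qed.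

Definition prime_ideal P :=
  [/\ is_ideal P, ~ P 1 & forall f g, P (f * g) -> P f \/ P g].

(** Zorn's lemma gives an ideal P that is maximal among those containing I and
    avoiding S. Maximality says that P together with any further f generates an
    element of S, and primality follows since S is multiplicative. The last
    conjunct keeps the maximality itself: with S the powers of a single element
    it says that P is a maximal ideal of the localization at that element. *)
Lemma exists_prime_avoiding I S :
    is_ideal I -> S 1 -> (forall s t, S s -> S t -> S (s * t)) ->
    (forall p, I p -> ~ S p) ->
  exists P, [/\ prime_ideal P, I `<=` P, forall p, P p -> ~ S p &
    forall f, ~ P f -> exists s g, S s /\ P (s - g * f)].
Proof.
move=> Iideal S1 SM IS.
(* [Zorn_bigcup] also asks for the union of the empty chain, which is empty:
   hence the maximal element is sought as the part X to be added to I. *)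
pose good (X : set A) := is_ideal (I `|` X) /\ forall p, X p -> ~ S p.
have [F Fgood Ftot|X [[Pideal XS] Xmax]] := @Zorn_bigcup A good.
  split; last by move=> p [X FX Xp]; apply: (Fgood X FX).2.
  have both X Y : F X -> F Y -> exists2 Z, F Z & X `<=` Z /\ Y `<=` Z.
    move=> FX FY; case: (Ftot _ _ FX FY) => XY.
      by exists Y => //; split=> // p.
    by exists X => //; split=> // p.
  have [I0 ID IM] := Iideal.
  split; first by left.
    move=> p q [Ip|[X FX Xp]] [Iq|[Y FY Yq]].
    - by left; apply: ID.
    - have [[_ D _] _] := Fgood _ FY.
      have [?|?] := D p q (or_introl Ip) (or_intror Yq); first by left.
      by right; exists Y.
    - have [[_ D _] _] := Fgood _ FX.
      have [?|?] := D p q (or_intror Xp) (or_introl Iq); first by left.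
      by right; exists X.
    - have [Z FZ [XZ YZ]] := both _ _ FX FY.
      have [[_ D _] _] := Fgood _ FZ.
      have [?|?] := D p q (or_intror (XZ _ Xp)) (or_intror (YZ _ Yq)).
        by left.
      by right; exists Z.
  move=> a p [Ip|[X FX Xp]]; first by left; apply: IM.
  have [[_ _ M] _] := Fgood _ FX.
  have [?|?] := M a p (or_intror Xp); first by left.
  by right; exists X.
pose P := I `|` X.
have PS p : P p -> ~ S p by move=> [Ip|Xp]; [exact: IS|exact: XS].
have Pmax f : ~ P f -> exists s g, S s /\ P (s - g * f).
  move=> nPf; apply: contrapT => nex.
  apply: (Xmax (adjoin_ideal P f)).
    split; first by move=> p Xp; apply: sub_adjoin_ideal; right.
    by move/(_ f (mem_adjoin_ideal f Pideal)) => Xf; apply: nPf; right.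
  rewrite /good; have -> : I `|` adjoin_ideal P f = adjoin_ideal P f.
    apply/seteqP; split=> p; last by right.
    by case=> // Ip; apply: sub_adjoin_ideal; left.
  split; first exact: adjoin_ideal_ideal.
  move=> s [a Pa [g def_s]] Ss; apply: nex; exists s, g; split=> //.
  by rewrite def_s addrK.
exists P; split=> //; last by move=> p Ip; left.
split=> // [P1|f g Pfg]; first exact: PS P1 S1.
have [Pf|nPf] := pselect (P f); first by left.
have [Pg|nPg] := pselect (P g); first by right.
have [s [a [Ss Psa]]] := Pmax _ nPf; have [t [b [St Ptb]]] := Pmax _ nPg.
have [_ PD PM] := Pideal; exfalso; apply: PS (SM _ _ Ss St).
have -> : s * t = t * (s - a * f) + (a * f) * (t - b * g) + (a * b) * (f * g).
  by ring.
by apply: (PD _ _ (PD _ _ _ _)); apply: PM.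
Qed.

End Ideals.

(** * Resolvents over an uncountable field *)

Section Resolvents.
Context {K : fieldType} {n : nat}.
Context (uncountableK : ~ countable [set: K]).
Local Notation A := {mpoly K[n]}.
Implicit Types (I : set A).

(** Polynomials of bounded degree live in a space whose dimension is the number
    of monomials up to that degree; one vector more than this is dependent. *)
Lemma bounded_mpoly_dependent D (g : nat -> A) :
    (forall k, mmeasure mdeg (g k) <= D)%N ->
  exists N (b : 'I_N -> K),
    (exists k, b k != 0) /\ \sum_(k < N) b k *: g k = 0.
Proof.
move=> gD; pose T := (bmultinom n D : finType).
pose M := \matrix_(k < #|T|.+1, j < #|T|) mcoeff (enum_val j) (g k).
(* Row k of M lists the coefficients of g k. *)
have : ~~ row_free M.
  by rewrite /row_free neq_ltn ltnS rank_leq_col.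
rewrite -kermx_eq0 => /rowV0Pn [u /sub_kermxP uM u0].
exists #|T|.+1, (u 0); split; first exact/rV0Pn.
apply/mpolyP => m; rewrite mcoeff0 linear_sum /=.
have [mD|Dm] := ltnP (mdeg m) D; last first.
  apply: big1 => k _; rewrite mcoeffZ memN_msupp_eq0 ?mulr0 //.
  by apply: msize_mdeg_ge; apply: leq_trans (gD k) Dm.
have := congr1 (fun v : 'rV_ _ => v 0 (enum_rank (BMultinom mD : T))) uM.
rewrite !mxE => uM0; rewrite -[RHS]uM0; apply: eq_bigr => k _.
by rewrite mcoeffZ mxE enum_rankK.
Qed.

Lemma infinite_fiber (e : K -> nat) :
  exists c : nat -> K, injective c /\ forall k l, e (c k) = e (c l).
Proof.
have [l einf] : exists l, infinite_set [set c | e c = l].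
  apply: contrapT => /forallNP fin; apply: uncountableK.
  rewrite (_ : setT = \bigcup_l [set c | e c = l]); last first.
    by apply/seteqP; split=> c // _; exists (e c).
  apply: bigcup_countable => // l _; apply: finite_set_countable.
  exact: contrapT (fin l).
have /infiniteP/card_leP [c] := einf.
pose idx (k : nat) : [set: nat] := exist _ k (mem_set I).
exists (val \o c \o idx); split=> [k m /val_inj /inj cE|k m].
  by have := cE (mem_set I) (mem_set I) => /(congr1 val).
have fib (x : [set c | e c = l]) : e (val x) = l by exact: set_valP x.
by rewrite /= !fib.
Qed.


(** Suppose that modulo I each x - c divides some q c, so that g c plays the
    part of q c / (x - c). Infinitely many c give a quotient g c of the same
    degree, hence finitely many of these quotients are linearly dependent, and
    multiplying the dependence by the product of the x - c clears the
    denominators. The label e ranges over a countable set as the degree does,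
    so it too can be made constant on the chosen c. *)
Lemma resolvent_relation I (x : A) (e : K -> nat) (q g : K -> A) :
    is_ideal I -> (forall c, I (q c - g c * (x - c%:A))) ->
  exists N (c : 'I_N -> K) (b : 'I_N -> K),
    [/\ injective c, exists k, b k != 0, forall k l, e (c k) = e (c l) &
      I (\sum_k b k *: (q (c k) * \prod_(l | l != k) (x - (c l)%:A)))].
Proof.
move=> Iideal Iqg.
have [c [c_inj c_fib]] :=
  infinite_fiber (fun c => pickle (e c, mmeasure mdeg (g c))).
have {}c_fib k l : (e (c k), mmeasure mdeg (g (c k))) =
                   (e (c l), mmeasure mdeg (g (c l))).
  by apply: (pcan_inj pickleK); apply: c_fib.
have [|N [b [b0 bg0]]] := @bounded_mpoly_dependent (mmeasure mdeg (g (c 0%N)))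
  (fun k => g (c k)); first by move=> k; have [_ ->] := c_fib k 0%N.
exists N, (fun k => c k), b; split=> //.
- by move=> k l /c_inj /val_inj.
- by move=> k l; have [] := c_fib k l.
set p := \sum_k _.
have -> : p = \sum_(k < N) (b k *: \prod_(l < N | l != k) (x - (c l)%:A)) *
                           (q (c k) - g (c k) * (x - (c k)%:A)).
  apply/eqP; rewrite -subr_eq0 -sumrB; apply/eqP.
  rewrite (eq_bigr (fun k : 'I_N =>
    \prod_(l < N) (x - (c l)%:A) * (b k *: g (c k)))) => [|k _].
    by rewrite -mulr_sumr bg0 mulr0.
  rewrite [\prod_(l < N) _](bigD1 k) //= -!mul_mpolyC.
  by move: (\prod_(_ < _ | _) _) => P; ring.
by apply: ideal_sum => // k; have [_ _] := Iideal; apply.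
Qed.

End Resolvents.

(** Evaluating at c k kills every summand but the k-th. This makes the
    relations produced by [resolvent_relation] nontrivial. *)
Lemma lagrange_sum_neq0 (L : idomainType) N (c a : 'I_N -> L) :
    injective c -> (exists k, a k != 0) ->
  \sum_k (a k)%:P * \prod_(l | l != k) ('X - (c l)%:P) != 0.
Proof.
move=> c_inj [k ak0]; apply/eqP => /(congr1 (horner^~ (c k))).
rewrite horner_sum horner0 (bigD1 k) //=.
rewrite [X in _ + X]big1 => [|j jk]; last first.
  rewrite hornerM horner_prod [X in _ * X](bigD1 k) 1?eq_sym //=.
  by rewrite hornerXsubC subrr mul0r mulr0.
apply/eqP; rewrite addr0 hornerM hornerC mulf_neq0 // horner_prod.
apply/prodf_neq0 => l lk; rewrite hornerXsubC subr_eq0.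
by apply: contraNneq lk => /c_inj ->.
Qed.

(** * The Nullstellensatz over an uncountable closed field *)

Section Nullstellensatz.
Context {K : closedFieldType} {n : nat}.
Context (uncountableK : ~ countable [set: K]).
Local Notation A := {mpoly K[n]}.
Implicit Types (P M : set A) (h : A).

Lemma prime_ideal_prod P (J : Type) (r : seq J) (F : J -> A) :
  prime_ideal P -> P (\prod_(j <- r) F j) -> exists j, P (F j).
Proof.
case=> _ P1 PM; elim: r => [|j r IHr]; first by rewrite big_nil => /P1.
by rewrite big_cons => /PM[Pj|/IHr//]; exists j.
Qed.

(** In the localization at h, M is a maximal ideal. If no x_i - c were in M,
    all of them would be invertible there, and [resolvent_relation] would make
    x_i a root of a nonzero one-variable polynomial F. The field is closed, so
    F splits into factors x_i - z, one of which lies in the prime M. *)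
Lemma maximal_ideal_root M h (i : 'I_n) :
    prime_ideal M -> (forall k, ~ M (h ^+ k)) ->
    (forall f, ~ M f -> exists k g, M (h ^+ k - g * f)) ->
  exists c, M ('x_i - c%:A).
Proof.
move=> Mprime Mh Mmax; have [Mideal M1 MM] := Mprime.
apply: contrapT => /forallNP nMx.
have /choice [k /choice [g Mg]] c : exists k g, M (h ^+ k - g * ('x_i - c%:A)).
  exact: Mmax.
have [N [c [b [c_inj b0 k_cst Msum]]]] :=
  resolvent_relation uncountableK k Mideal Mg.
have [k0 bk0] := b0.
pose F := \sum_k (b k)%:P * \prod_(l | l != k) ('X - (c l)%:P).
have F0 : F != 0 by apply: lagrange_sum_neq0.
(* The exponent k is the label kept constant: the power of h factors out. *)
have {Msum} : M (h ^+ k (c k0) * horner_alg 'x_i F).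
  rewrite [X in M X](_ : _ = \sum_j b j *: (h ^+ k (c j) *
    \prod_(l | l != j) ('x_i - (c l)%:A))) // rmorph_sum mulr_sumr.
  apply: eq_bigr => j _; rewrite rmorphM /= horner_algC rmorph_prod /=.
  under eq_bigr do rewrite rmorphB /= horner_algX horner_algC.
  by rewrite (k_cst k0 j) mulrCA mulr_algl.
case/MM => [/Mh//|].
have [r ->] := closed_field_poly_normal F.
rewrite linearZ /= => /MM[].
  move=> MF; apply: M1; have [_ _ IM] := Mideal.
  rewrite [1](_ : _ = (lead_coef F)^-1%:A * (lead_coef F)%:A).
    exact: IM.
  by rewrite mulr_algl scalerA mulVf ?lead_coef_eq0 // scale1r.
rewrite rmorph_prod /= => /(prime_ideal_prod Mprime) [z].
rewrite rmorphB /= horner_algX horner_algC; exact: nMx.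
Qed.

(** Modulo the x_i - z_i every polynomial is congruent to its value at z,
    because congruence to the value is preserved by sums and products. *)
Lemma mpoly_sub_meval_ideal M (z : 'I_n -> K) p :
  is_ideal M -> (forall i, M ('x_i - (z i)%:A)) -> M (p - (meval z p)%:A).
Proof.
move=> Mideal Mz; have [M0 MD MM] := Mideal.
pose Q := [set p : A | M (p - (meval z p)%:A)].
have QM p1 p2 : Q p1 -> Q p2 -> Q (p1 * p2).
  rewrite /Q /= => Q1 Q2; rewrite mevalM.
  rewrite (_ : _ - _ = p2 * (p1 - (meval z p1)%:A) +
    (meval z p1)%:A * (p2 - (meval z p2)%:A)); first by apply: MD; apply: MM.
  by rewrite !alg_mpolyC mpolyCM; ring.
have Q1 : Q 1 by rewrite /Q /= meval1 scale1r subrr.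
suff : Q p by [].
rewrite [p]mpolyE; apply: (big_ind Q) => [|p1 p2|m _].
- by rewrite /Q /= meval0 scale0r subrr.
- by rewrite /Q /= => ? ?; rewrite mevalD scalerDl opprD addrACA; apply: MD.
rewrite -mulr_algl.
apply: (QM); first by rewrite /Q /= mevalZ meval1 mulr1 subrr.
rewrite mpolyXE_id; apply: (big_ind Q Q1 QM) => i _.
elim: (m i) => [|k IHk]; rewrite ?expr0 // exprS; apply: (QM) => //.
by rewrite /Q /= mevalXU.
Qed.

(** Enlarge P to an ideal M that is maximal among those avoiding the powers of
    h. By [maximal_ideal_root] M contains x_i - z_i for some point z, and then
    membership in M is vanishing at z. *)
Theorem nullstellensatz P h :
  prime_ideal P -> ~ P h -> exists2 z, zero_set P z & meval z h != 0.
Proof.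
move=> [Pideal P1 PM] Ph.
have hP p : P p -> ~ [set s | exists k, s = h ^+ k] p.
  move=> + [k def_p]; rewrite {p}def_p.
  elim: k => [|k IHk]; first by rewrite expr0.
  by rewrite exprS => /PM[].
have [||M [Mprime PM' Mh Mmax]] := exists_prime_avoiding Pideal _ _ hP.
- by exists 0%N; rewrite expr0.
- by move=> _ _ [k ->] [l ->]; exists (k + l)%N; rewrite exprD.
have [Mideal M1 _] := Mprime.
have /choice [z Mz] i : exists c, M ('x_i - c%:A).
  apply: (maximal_ideal_root (h := h)) => // [k Mk|f /Mmax [_ [g [[k ->] Mg]]]].
    by apply: Mh Mk _; exists k.
  by exists k, g.
have Mev p : M p -> meval z p = 0.
  move=> Mp; apply/eqP; apply: contrapT => /negP pz; apply: M1.
  have [_ _ IM] := Mideal.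
  have := IM (meval z p)^-1%:A _
    (idealB Mideal Mp (mpoly_sub_meval_ideal p Mideal Mz)).
  by rewrite opprB addrC subrK mulr_algl scalerA mulVf // scale1r.
exists z => [p /PM'/Mev//|]; apply/eqP => hz.
apply: (Mh h); last by exists 1%N.
by have := mpoly_sub_meval_ideal h Mideal Mz; rewrite hz scale0r subr0.
Qed.

End Nullstellensatz.

(** * Algebraic independence and chains of irreducible sets *)

Section Bivariate.
Context {K : fieldType} {A : comAlgType K}.

(** The coefficients are polynomials in y and the main variable is x: this
    order lets a relation be divided by x, and its value at x = 0 be read off
    as the constant coefficient. *)
Definition bieval (x y : A) : {poly {poly K}} -> A :=
  horner_eval x \o map_poly (horner_alg y).

HB.instance Definition _ x y := GRing.RMorphism.copy (bieval x y)
  (horner_eval x \o map_poly (horner_alg y)).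

Lemma bievalX x y : bieval x y 'X = x.
Proof. by rewrite /bieval /= map_polyX horner_evalE hornerX. Qed.

Lemma bievalC x y r : bieval x y r%:P = horner_alg y r.
Proof. by rewrite /bieval /= map_polyC horner_evalE hornerC. Qed.

Lemma bieval_XsubC x y r : bieval x y ('X - r%:P) = x - horner_alg y r.
Proof. by rewrite rmorphB /= bievalX bievalC. Qed.

End Bivariate.

Section Chain.
Context {K : closedFieldType} {n : nat}.
Context (uncountableK : ~ countable [set: K]).
Local Notation A := {mpoly K[n]}.
Implicit Types (I P : set A).

(** If f vanishes on one closed set but is not in P, and g on the other, then f
    g vanishes on the whole zero set, so it is in P by the Nullstellensatz. *)
Lemma prime_zero_set_irreducible P :
  prime_ideal P -> zariski_irreducible (zero_set P).
Proof.
move=> Pprime; have [Pideal P1 PM] := Pprime; split.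
  by have [z Pz _] := nullstellensatz uncountableK Pprime P1; exists z.
move=> _ _ [B1 ->] [B2 ->] sub.
have [|] := pselect (B1 `<=` P) => [B1P|].
  by left=> z Pz p /B1P; apply: Pz.
move=> /existsNP [f /not_implyP [B1f nPf]]; right=> z Pz g B2g.
have : P (f * g).
  apply: contrapT => /(nullstellensatz uncountableK Pprime) [w Pw].
  rewrite mevalM mulf_eq0 => /norP [/eqP fw /eqP gw].
  by case: (sub w Pw) => Bw; [apply: fw|apply: gw]; apply: Bw.
by case/PM => // Pg; apply: Pz.
Qed.

Lemma prime_zero_set_proper P (i : 'I_n) (c : K) (X : set ('I_n -> K)) :
    prime_ideal P -> ~ P ('x_i - c%:A) -> (forall z, X z -> z i = c) ->
  ~ zero_set P `<=` X.
Proof.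
move=> Pprime Pxc Xc PX.
have [z Pz] := nullstellensatz uncountableK Pprime Pxc.
by rewrite mevalB mevalXU mevalZ meval1 mulr1 (Xc z (PX z Pz)) subrr eqxx.
Qed.

Lemma point_zariski_closed (z : 'I_n -> K) : zariski_closed [set z].
Proof.
exists [set p | exists i, p = 'x_i - (z i)%:A].
apply/seteqP; split=> [_ -> _ [i ->]|w zw].
  by rewrite mevalB mevalXU mevalZ meval1 mulr1 subrr.
apply/funext => i; apply/eqP; rewrite -subr_eq0; apply/eqP.
rewrite -(zw ('x_i - (z i)%:A)); last by exists i.
by rewrite mevalB mevalXU mevalZ meval1 mulr1.
Qed.

Lemma point_zariski_irreducible (z : 'I_n -> K) : zariski_irreducible [set z].
Proof.
split=> [|B C _ _ /(_ z erefl)[Bz|Cz]]; first by exists z.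
  by left=> _ ->.
by right=> _ ->.
Qed.

(** Algebraic form of the statement that for some c the slice x_i = c of the
    zero set of P still has infinitely many values of x_j. If every c failed,
    each x_i - c would divide a nonzero polynomial r c in x_j modulo P, and
    [resolvent_relation] would give a nonzero relation between x_i and x_j. *)
Lemma exists_independent_fiber P (i j : 'I_n) :
    prime_ideal P -> (forall f, f != 0 -> ~ P (bieval 'x_i 'x_j f)) ->
  exists c, forall r, r != 0 ->
    ~ adjoin_ideal P ('x_i - c%:A) (horner_alg 'x_j r).
Proof.
move=> [Pideal P1 PM] Pf; apply: contrapT => /forallNP noc.
have {noc} /choice [r /choice [g Pg]] c : exists r g,
    r != 0 /\ P (horner_alg 'x_j r - g * ('x_i - c%:A)).
  have /existsNP [r /not_implyP [r0 /contrapT [a Pa [g def_r]]]] := noc c.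
  by exists r, g; split=> //; rewrite def_r addrK.
have [N [c [b [c_inj [k bk0] _]]]] := resolvent_relation uncountableK
  (fun=> 0%N) Pideal (fun c => (Pg c).2).
pose F := \sum_k (b k *: r (c k))%:P *
                 \prod_(l | l != k) ('X - ((c l)%:P)%:P) : {poly {poly K}}.
have /Pf PF : F != 0.
  apply: (lagrange_sum_neq0 (c := polyC \o c)) => [k' l' /polyC_inj /c_inj //|].
  by exists k; rewrite scaler_eq0 negb_or bk0 (Pg (c k)).1.
rewrite [X in P X](_ : _ = bieval 'x_i 'x_j F) // rmorph_sum /=.
apply: eq_bigr => l _; rewrite rmorphM /= bievalC linearZ /= mulr_algl.
rewrite scalerAl; congr (_ * _); rewrite rmorph_prod; apply: eq_bigr => m _.
by rewrite /= bieval_XsubC horner_algC.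
Qed.

(** The zero set of I dominates the (x_i, x_j)-plane. The chain consists of an
    irreducible set Z(P2) that still dominates the plane, an irreducible subset
    Z(P1) of one of its slices x_i = c that still dominates the x_j-line, and a
    point of Z(P1). *)
Theorem independent_pair_chain I (i j : 'I_n) :
    is_ideal I -> (forall f, f != 0 -> ~ I (bieval 'x_i 'x_j f)) ->
  exists Y : 'I_3 -> set ('I_n -> K), irreducible_chain (zero_set I) Y.
Proof.
move=> Iideal If.
have IS p : I p -> ~ [set bieval 'x_i 'x_j f | f in [set f | f != 0]] p.
  by move=> Ip [f f0 def_p]; apply: (If f f0); rewrite def_p.
have [||P2 [P2prime IP2 P2S _]] := exists_prime_avoiding Iideal _ _ IS.
- by exists 1; rewrite /= ?oner_neq0 ?rmorph1.
- move=> _ _ [f f0 <-] [g g0 <-].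
  by exists (f * g); rewrite /= ?mulf_neq0 ?rmorphM.
have P2f f : f != 0 -> ~ P2 (bieval 'x_i 'x_j f).
  by move=> f0 /P2S; apply; exists f.
have [c cP] := exists_independent_fiber P2prime P2f.
have [P2ideal _ _] := P2prime.
have JS p : adjoin_ideal P2 ('x_i - c%:A) p ->
    ~ [set horner_alg 'x_j r | r in [set r | r != 0]] p.
  by move=> Jp [r r0 def_p]; apply: (cP r r0); rewrite def_p.
have [||P1 [P1prime JP1 P1S _]] :=
  exists_prime_avoiding (adjoin_ideal_ideal _ P2ideal) _ _ JS.
- by exists 1; rewrite /= ?oner_neq0 ?rmorph1.
- move=> _ _ [f f0 <-] [g g0 <-].
  by exists (f * g); rewrite /= ?mulf_neq0 ?rmorphM.
have [[z P1z] _] := prime_zero_set_irreducible P1prime.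
have P21 : zero_set P1 `<=` zero_set P2.
  by move=> w P1w p P2p; apply/P1w/JP1/sub_adjoin_ideal.
have P2I : zero_set P2 `<=` zero_set I by move=> w P2w p /IP2; apply: P2w.
pose Y (k : 'I_3) := nth set0 [:: [set z]; zero_set P1; zero_set P2] k.
have Y01 : [set z] `<` zero_set P1.
  split; first by move=> _ ->.
  apply: (prime_zero_set_proper (i := j) (c := z j)) => // [P1xj|_ -> //].
  apply: P1S P1xj _; exists ('X - (z j)%:P); rewrite /= ?polyXsubC_eq0 //.
  by rewrite rmorphB /= horner_algX horner_algC.
have Y12 : zero_set P1 `<` zero_set P2.
  split=> //; apply: (prime_zero_set_proper (i := i) (c := c)) => //.
    move=> P2xc; apply: (P2f ('X - (c%:P)%:P)); first by rewrite polyXsubC_eq0.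
    by rewrite bieval_XsubC horner_algC.
  move=> w P1w; apply/eqP; rewrite -subr_eq0; apply/eqP.
  rewrite -(P1w ('x_i - c%:A)); last exact/JP1/mem_adjoin_ideal.
  by rewrite mevalB mevalXU mevalZ meval1 mulr1.
exists Y; split=> [k|].
  case: k => [[|[|[|//]]] ?] /=; rewrite /Y /=.
  - split; [exact: point_zariski_closed|exact: point_zariski_irreducible|].
    by move=> _ ->; apply/P2I/P21.
  - split; [by exists P1|exact: prime_zero_set_irreducible|].
    exact: subset_trans P21 P2I.
  - by split; [exists P2|exact: prime_zero_set_irreducible|].
case=> [[|[|[|//]]] ?] [[|[|[|//]]] ?] //= _; rewrite /Y //=.
have [[Y01s _] [Y12s Y12p]] := (Y01, Y12).
split=> [|Y20]; first exact: subset_trans Y01s Y12s.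
by apply: Y12p; apply: subset_trans Y20 _.
Qed.

End Chain.

(** * Quotients in which every coordinate is algebraic *)

Section BoundedQuotient.
Context {K : fieldType} {n : nat}.
Local Notation A := {mpoly K[n]}.
Implicit Types (J : set A) (p q : A).

Lemma msize_horner_alg_le i (r : {poly K}) :
  (mmeasure mdeg (horner_alg ('x_i : A) r) <= size r)%N.
Proof.
rewrite -{1}[r]coefK poly_def linear_sum /=.
apply: leq_trans (msize_sum _ _ _) _; apply/bigmax_leqP => k _.
rewrite linearZ /= mulr_algl rmorphXn /= horner_algX mpolyXn.
apply: leq_trans (msizeZ_le _ _) _.
by rewrite mmeasureX /= mdegMn mdeg1 mul1n.
Qed.

Lemma msizeM_le_add p q :
  (mmeasure mdeg (p * q) <= mmeasure mdeg p + mmeasure mdeg q)%N.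
Proof.
have [->|p0] := eqVneq p 0; first by rewrite mul0r mmeasure0.
have [->|q0] := eqVneq q 0; first by rewrite mulr0 mmeasure0.
by rewrite msizeM // leq_pred.
Qed.

Lemma msize_prod_le (F : 'I_n -> A) :
  (mmeasure mdeg (\prod_i F i) <= (\sum_i mmeasure mdeg (F i)).+1)%N.
Proof.
elim/big_rec2: _ => [|i d p _ pd]; first by rewrite msize1.
by apply: leq_trans (msizeM_le_add _ _) _; rewrite -addnS leq_add2l.
Qed.

Lemma ideal_prodB J (F G : 'I_n -> A) :
  is_ideal J -> (forall i, J (F i - G i)) -> J (\prod_i F i - \prod_i G i).
Proof.
move=> Jideal JFG; have [J0 JD JM] := Jideal.
elim/big_rec2: _ => [|i p q _ Jpq]; first by rewrite subrr.
rewrite (_ : _ - _ = q * (F i - G i) + G i * (q - p)); last by ring.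
by apply: (JD); apply: (JM).
Qed.

(** Reduce each power of x_i modulo its own relation r i: every monomial
    becomes a product of one-variable polynomials of degree less than those of
    the r i. Hence the quotient by J is spanned by monomials of degree below D.
*)
Theorem algebraic_generators_bounded J :
    is_ideal J ->
    (forall i : 'I_n, exists2 r, r != 0 & J (horner_alg 'x_i r)) ->
  exists D, forall p, exists2 q, (mmeasure mdeg q <= D)%N & J (p - q).
Proof.
move=> Jideal Jalg; have [J0 JD JM] := Jideal.
have /choice [r /all_and2 [r0 Jr]] i : exists r : {poly K},
    r != 0 /\ J (horner_alg 'x_i r) by have [r] := Jalg i; exists r.
pose D := (\sum_i size (r i)).+1; exists D.
suff red m : exists2 q, (mmeasure mdeg q <= D)%N &
    J (mpolyX K m - q).
  move=> p; rewrite [p]mpolyE.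
  elim/big_rec: _ => [|m p' _ [q' q'D Jq']].
    by exists 0; rewrite ?mmeasure0 ?subrr.
  have [q qD Jq] := red m; exists (mcoeff m p *: q + q').
    apply: leq_trans (msizeD_le _ _) _; rewrite geq_max q'D andbT.
    exact: leq_trans (msizeZ_le _ _) qD.
  rewrite opprD addrACA; apply: (JD) => //.
  by rewrite -scalerBr -mul_mpolyC; apply: JM.
pose s i := 'X^(m i) %% r i.
exists (\prod_i horner_alg 'x_i (s i)).
  apply: leq_trans (msize_prod_le _) _; rewrite ltnS.
  apply: leq_sum => i _; apply: leq_trans (msize_horner_alg_le _ _) _.
  by rewrite ltnW // ltn_modp.
rewrite mpolyXE_id; apply: ideal_prodB => // i.
rewrite (_ : 'x_i ^+ m i = horner_alg 'x_i 'X^(m i)); last first.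
  by rewrite rmorphXn /= horner_algX.
rewrite -rmorphB /=.
rewrite {1}(divp_eq 'X^(m i) (r i)) addrK rmorphM; exact: (JM _ _ (Jr i)).
Qed.

End BoundedQuotient.

(** * Inner products *)

Section InnerProduct.
Context {C : numClosedFieldType} {U : lmodType C}.
Context (dot : {dot U for Num.conj}).
Implicit Types (u v : U).

Lemma dotC u v : dot u v = (dot v u)^*.
Proof. by rewrite hermC expr0 mul1r. Qed.

Lemma dot_eq0C u v : dot u v = 0 -> dot v u = 0.
Proof. by move=> uv0; rewrite dotC uv0 conjC0. Qed.

Lemma dot_self_eq0 u : dot u u = 0 -> u = 0.
Proof. by move/eqP; rewrite dnorm_eq0 => /eqP. Qed.

(** With t v the projection of u on the line of v, the squared length of u
    drops by exactly the squared length of that projection. Both the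
    Cauchy-Schwarz inequality and the orthogonality of a nearest point are read
    off from it. *)
Lemma dot_line_projection u v : exists t,
  `|dot u v| ^+ 2 = (dot u u - dot (u - t *: v) (u - t *: v)) * dot v v.
Proof.
have [->|v0] := eqVneq v 0.
  by exists 0; rewrite [dot u 0]linear0r [dot 0 0]linear0r normr0 expr0n mulr0.
have s0 : dot v v != 0 by rewrite dnorm_eq0.
exists (dot u v / dot v v); set t := _ / _.
have sR : (dot v v)^* = dot v v by rewrite -dotC.
have tR : t^* * dot u v = `|dot u v| ^+ 2 / dot v v.
  by rewrite rmorphM fmorphV /= sR mulrAC normCKC.
have tRC : (t^* * dot u v)^* = t^* * dot u v.
  by apply: conj_Creal; rewrite tR ger0_real // divr_ge0 ?exprn_ge0 ?dnorm_ge0.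
rewrite dnormB dnormZ linearZr_LR /= tRC tR normrM normfV.
rewrite (ger0_norm (dnorm_ge0 _ v)).
by field.
Qed.

(** The parallelogram law, arranged so that the midpoint of two almost nearest
    points bounds their distance. *)
Lemma parallelogram u v : dot (u - v) (u - v) =
  (dot u u + dot v v) *+ 2 - dot (2^-1 *: (u + v)) (2^-1 *: (u + v)) *+ 4.
Proof.
rewrite dnormB dnormZ dnormD normfV normr_nat /=; move: (_ + _^*) => e.
by field.
Qed.

(** Polarization: the defect b is sesquilinear and vanishes on the diagonal, so
    it is antisymmetric; replacing v by 'i v shows that it is symmetric as
    well. *)
Lemma isometry_dot (f : {linear U -> U}) :
  (forall x, dot (f x) (f x) = dot x x) ->
  forall u v, dot (f u) (f v) = dot u v.
Proof.
move=> f2.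
pose b u v := dot (f u) (f v) - dot u v.
have b2 u v : b u v + b v u = 0.
  have := f2 (u + v); rewrite linearD /= !linearDl /= !linearDr /= !f2 /b.
  move/eqP; rewrite -subr_eq0 => /eqP <-; ring.
move=> u v; apply/eqP; rewrite -subr_eq0 -/(b u v); apply/eqP.
have bi : 'i * (b u v - b v u) = 0.
  rewrite -oppr0 -[in RHS](b2 u ('i *: v)) /b linearZ /= !linearZl_LR /=.
  rewrite !linearZr_LR /= (_ : _^* = - 'i); last by rewrite conjCi.
  ring.
have /eqP := bi; rewrite mulf_eq0 (negPf (neq0Ci _)) /= subr_eq0 => /eqP e.
have /eqP := b2 u v; rewrite -e -mulr2n mulrn_eq0 /=; exact/eqP.
Qed.

End InnerProduct.

(** * Orthogonal projection *)

Section Projection.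
Context {R : realType} {H : completeNormedModType R[i]}.
Context (dot : {dot H for Num.conj}) (hilbertH : hilbert_dot dot).
Implicit Types (u v x y : H) (D : set H) (f : {linear H -> H}).

(** Squared distances are complex numbers here, whose order is only partial; on
    nonnegative ones it is that of the real parts. *)
Lemma complex_nonneg_inf (S : set R[i]) :
    S !=set0 -> (forall s, S s -> 0 <= s) ->
  exists2 a, forall s, S s -> a <= s &
    forall e, 0 < e -> exists2 s, S s & s < a + e.
Proof.
move=> [s0 Ss0] S0.
have ReK (s : R[i]) : 0 <= s -> (complex.Re s)%:C%C = s.
  by move/ger0_real/RRe_real.
pose T := [set complex.Re s | s in S].
have Tinf : has_inf T.
  split; first by exists (complex.Re s0), s0.
  by exists 0 => _ [s Ss <-]; rewrite -lecR ReK //; apply: S0.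
exists (inf T)%:C%C => [s Ss|e e0].
  rewrite -[s]ReK ?S0 // lecR; apply: ge_inf; first exact: Tinf.2.
  by exists s.
have Re0 : 0 < complex.Re e by rewrite -ltcR ReK // ltW.
have [_ [s Ss <-] s_lt] := inf_adherent Re0 Tinf; exists s => //.
by rewrite -[s]ReK ?S0 // -[e]ReK ?ltW // -rmorphD ltcR.
Qed.

Definition is_subspace D := D 0 /\ forall a u v, D u -> D v -> D (a *: u + v).

Lemma cauchy_schwarz u v : `|dot u v| <= `|u| * `|v|.
Proof.
have [t def_uv] := dot_line_projection dot u v.
rewrite -(@ler_pXn2r _ 2) ?nnegrE ?mulr_ge0 // exprMn !hilbertH def_uv.
by rewrite ler_wpM2r ?dnorm_ge0 // gerBl dnorm_ge0.
Qed.

Lemma isometry_dot_of_norm f : (forall x, `|f x| = `|x|) ->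
  forall u v, dot (f u) (f v) = dot u v.
Proof. by move=> f_iso; apply: isometry_dot => x; rewrite -!hilbertH f_iso. Qed.

(** Minimize the distance from x to f d for d in D. Since f is isometric, the
    parallelogram law shows that almost minimizing d are close to each other,
    so they converge to some z; almost minimality makes x - f d almost
    orthogonal to f D, and the error disappears in the limit. Two cases are
    used: f an isometry with D the whole space, which projects on the range of
    f, and f the identity with D arbitrary, which tests the density of D. *)
Theorem orthogonal_projection f D x :
    (forall x, `|f x| = `|x|) -> is_subspace D ->
  exists2 z, closure D z & forall d, D d -> dot (f d) (x - f z) = 0.
Proof.
move=> f_iso [D0 Dlin].
have DD u v : D u -> D v -> D (u + v) by move=> /(Dlin 1) h /h; rewrite scale1r.
have DZ a u : D u -> D (a *: u) by move=> /(Dlin a) /(_ D0); rewrite addr0.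
pose r d := dot (x - f d) (x - f d).
have [|s [d _ <-]|a a_le a_inf] := @complex_nonneg_inf [set r d | d in D].
- by exists (r 0), 0.
- exact: dnorm_ge0.
(* The almost minimizing points, and the filter that they generate. *)
pose B (e : R[i]) := [set d | D d /\ r d < a + e ^+ 2].
pose F := filter_from [set e : R[i] | 0 < e] B.
have FF : ProperFilter F.
  apply: filter_from_proper => [|e /= e0].
    apply: filter_from_filter; first by exists 1; apply: ltr01.
    move=> e e' /= e0 e'0.
    have Bmono e1 e2 : 0 < e1 -> e1 <= e2 -> B e1 `<=` B e2.
      move=> e10 e12 d [Dd rd]; split=> //; apply: lt_le_trans rd _.
      by rewrite lerD2l lerXn2r // ?nnegrE ltW // (lt_le_trans e10).
    have [ee'|e'e] := orP (real_leVge (gtr0_real e0) (gtr0_real e'0)).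
      by exists e => // d Bd; split=> //; apply: Bmono ee' _ Bd.
    by exists e' => // d Bd; split=> //; apply: Bmono e'e _ Bd.
  have [_ [d Dd <-] rd] := a_inf (e ^+ 2) (exprn_gt0 _ e0).
  by exists d.
have near_dist e d d' : 0 < e -> B (e / 2) d -> B (e / 2) d' -> `|d' - d| < e.
  move=> e0 [Dd rd] [Dd' rd'].
  rewrite -(@ltr_pXn2r _ 2) ?nnegrE ?(ltW e0) // -f_iso hilbertH.
  have := parallelogram dot (x - f d) (x - f d').
  have -> : x - f d - (x - f d') = f (d' - d).
    by rewrite [f (_ - _)]linearB /= opprD opprK addrACA subrr add0r addrC.
  have -> : 2^-1 *: (x - f d + (x - f d')) = x - f (2^-1 *: (d + d')).
    rewrite [f (_ *: _)]linearZ [f (_ + _)]linearD /= addrACA -opprD scalerBr.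
    congr (_ - _).
    by rewrite -mulr2n -[x *+ 2]scaler_nat scalerA mulVf ?scale1r // pnatr_eq0.
  move=> ->; rewrite -/(r d) -/(r d') -/(r (2^-1 *: (d + d'))).
  have {}a_le : a <= r (2^-1 *: (d + d')).
    by apply: a_le; exists (2^-1 *: (d + d')) => //; apply/DZ/DD.
  have -> : e ^+ 2 = (a + (e / 2) ^+ 2 + (a + (e / 2) ^+ 2)) *+ 2 - a *+ 4.
    by field.
  by rewrite ltr_leB ?lerMn2r // ltrMn2r /= ltrD.
have /cvg_ex [z Fz] : cvg F.
  apply: cauchy_cvg; apply: cauchy_exP => e e0.
  have e20 : 0 < e / 2 by rewrite divr_gt0.
  have [d Bd] := filter_ex (F := F) (ex_intro2 _ _ (e / 2) e20 (fun d h => h)).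
  exists d, (e / 2) => // d' Bd'; rewrite -ball_normE /ball_ /= distrC.
  exact: near_dist.
have zB e : 0 < e -> exists2 d, B e d & `|d - z| < e.
  move=> e0; have FB : F (B e `&` ball z e).
    apply: filterI; first by exists e.
    by apply: Fz; apply: nbhsx_ballx.
  have [d [Bd]] := filter_ex FB.
  by rewrite -ball_normE /ball_ /= distrC; exists d.
exists z => [W /nbhs_ballP [e /= e0 eW]|w Dw].
  have [d [Dd _] dz] := zB e e0; exists d; split=> //; apply: eW.
  by rewrite -ball_normE /ball_ /= distrC.
(* The inner product c with f w is below 2 e `|w| for every e; at the value
   e = `|c| / (2 `|w|) this reads `|c| < `|c|. *)
apply/dot_eq0C/eqP; apply: contrapT => /negP c0.
set c := dot _ _ in c0.
have w0 : 0 < `|w|.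
  rewrite normr_gt0; apply: contraNneq c0 => w0.
  by rewrite /c w0 linear0 linear0r.
have bound e : 0 < e -> `|c| < 2 * (e * `|w|).
  move=> e0; have [d [Dd rd] dz] := zB e e0.
  have -> : c = dot (x - f d) (f w) + dot (f (d - z)) (f w).
    by rewrite -linearDl /= linearB /= addrA subrK.
  apply: le_lt_trans (ler_normD _ _) _; rewrite mulrDl mul1r; apply: ler_ltD.
    have [t def_dw] := dot_line_projection dot (x - f d) (f w).
    rewrite -(@ler_pXn2r _ 2) ?nnegrE ?mulr_ge0 ?(ltW e0) // exprMn def_dw.
    rewrite -[dot (f w) (f w)]hilbertH f_iso ler_wpM2r ?exprn_ge0 //.
    rewrite -(addrK a (e ^+ 2)) (addrC _ a) lerB ?(ltW rd) //; apply: a_le.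
    exists (d + t *: w); first by apply: DD => //; apply: DZ.
    by rewrite /r [f (_ + _)]linearD [f (_ *: _)]linearZ /= opprD addrA.
  apply: le_lt_trans (cauchy_schwarz _ _) _.
  by rewrite !f_iso ltr_pM2r.
have := bound (`|c| / (2 * `|w|)).
rewrite (_ : 2 * (_ * _) = `|c|) ?ltxx => [/(_ _)/negP|]; last first.
  rewrite -mulrA mulrCA [2 * (_ * _)]mulrCA mulVf ?mulr1 //.
  by rewrite mulf_neq0 ?pnatr_eq0 // gt_eqF.
by apply; rewrite // divr_gt0 ?normr_gt0 // mulr_gt0.
Qed.

Lemma isometry_range_split f x : (forall x, `|f x| = `|x|) ->
  exists z, forall d, dot (f d) (x - f z) = 0.
Proof.
move=> f_iso.
have [|z _ fz] := orthogonal_projection (D := setT) x f_iso; first by split.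
by exists z => d; apply: fz.
Qed.

End Projection.

(** * Linear spans *)

Section Spans.
Context {R : realType} {H : completeNormedModType R[i]}.
Implicit Types (D E : set H).

Lemma sub_lspan E : E `<=` lspan E.
Proof.
move=> e Ee; exists 1%N, (fun=> 1), (fun=> e); split=> //.
by rewrite big_ord1 scale1r.
Qed.

Lemma lspan_subspace E : is_subspace (lspan E).
Proof.
split.
  by exists 0%N, (fun=> 0), (fun=> 0); split; [case|rewrite big_ord0].
move=> a _ _ [k [c [e [Ee ->]]]] [l [d [g [Eg ->]]]].
exists (k + l)%N.
exists (fun i =>
  match fintype.split i with inl j => a * c j | inr j => d j end).
exists (fun i => match fintype.split i with inl j => e j | inr j => g j end).
split=> [i|]; first by case: (fintype.split i).
rewrite big_split_ord /= scaler_sumr; congr (_ + _); apply: eq_bigr => i _.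
  by rewrite (unsplitK (inl i)) scalerA.
by rewrite (unsplitK (inr i)).
Qed.

Lemma subspace_sum D (I : Type) (r : seq I) (F : I -> H) :
  is_subspace D -> (forall i, D (F i)) -> D (\sum_(i <- r) F i).
Proof.
move=> [D0 Dlin] DF; elim/big_ind: _ => // u v Du Dv.
by rewrite -[u]scale1r; apply: Dlin.
Qed.

Lemma subspaceZ D a u : is_subspace D -> D u -> D (a *: u).
Proof. by move=> [D0 Dlin] Du; rewrite -[_ *: _]addr0; apply: Dlin. Qed.

Lemma lspan_min D E : is_subspace D -> E `<=` D -> lspan E `<=` D.
Proof.
move=> Dsub ED _ [k [c [e [Ee ->]]]]; apply: subspace_sum => // i.
by apply: subspaceZ => //; apply: ED.
Qed.

End Spans.

(** * Adjoints of isometries and wandering subspaces *)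

Section Orthogonality.
Context {R : realType} {H : completeNormedModType R[i]}.
Context (dot : {dot H for Num.conj}) (hilbertH : hilbert_dot dot).
Implicit Types (D E : set H) (x y g : H) (f : {linear H -> H}).

Lemma orthogonal_subspace g : is_subspace [set x | dot x g = 0].
Proof.
split=> [|a u v /= ug vg]; first by rewrite /= linear0l.
by rewrite linearDl linearZl_LR /= ug vg mulr0 addr0.
Qed.

Lemma orthogonal_subspace_r x : is_subspace [set g | dot x g = 0].
Proof.
split=> [|a u v /= ug vg]; first by rewrite /= linear0r.
by rewrite linearDr linearZr_LR /= ug vg mulr0 addr0.
Qed.

(** A vector d orthogonal to g is at distance at least `|g| from g, by
    Pythagoras. *)
Lemma dense_orthogonal_eq0 D g :
  dense D -> (forall d, D d -> dot d g = 0) -> g = 0.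
Proof.
move=> Ddense Dg; apply/eqP; apply: contrapT => /negP; rewrite -normr_gt0 => g0.
have [|d [gd Dd]] := Ddense (ball g `|g|) _ (ball_open _ _).
  by exists g; apply: ballxx.
move: gd; rewrite -ball_normE /ball_ /= => gd.
suff : `|g| < `|g| by rewrite ltxx.
apply: le_lt_trans gd; rewrite -(@ler_pXn2r _ 2) ?nnegrE // !hilbertH dnormB.
rewrite (dot_eq0C (Dg d Dd)) conjC0 addr0 subr0 lerDl; exact: dnorm_ge0.
Qed.

(** Gram-Schmidt, one vector at a time: u is the component of the new vector e
    orthogonal to the span of s, and the projection on that span is corrected
    by a multiple of u. *)
Lemma finite_span_projection (s : seq H) x :
  exists2 y, lspan [set` s] y & forall d, d \in s -> dot d (x - y) = 0.
Proof.
elim: s x => [|e s IHs] x.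
  by exists 0 => //; have [] := lspan_subspace [set` [::] : seq H].
have [y sy yx] := IHs x; have [e' se' e'e] := IHs e.
have [u def_u] : exists u, u = e - e' by exists (e - e').
pose t := dot (x - y) u / dot u u.
have sub : lspan [set` s] `<=` lspan [set` e :: s].
  apply: lspan_min; first exact: lspan_subspace.
  by move=> d ds; apply: sub_lspan; rewrite /= inE ds orbT.
have [_ Slin] := lspan_subspace [set` e :: s].
have Su : lspan [set` e :: s] u.
  rewrite def_u addrC -scaleN1r; apply: Slin; first exact: sub.
  by apply: sub_lspan; rewrite /= mem_head.
exists (t *: u + y); first by apply: Slin => //; apply: sub.
have su d : lspan [set` s] d -> dot d u = 0.
  rewrite def_u; move: d.
  by apply: lspan_min; [apply: orthogonal_subspace|apply: e'e].
have sxy d : lspan [set` s] d -> dot d (x - y) = 0.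
  by move: d; apply: lspan_min; [apply: orthogonal_subspace|apply: yx].
have split_dot d : dot d (x - (t *: u + y)) = dot d (x - y) - t^* * dot d u.
  rewrite opprD addrA addrAC [dot d (_ + _)]linearBr linearZr_LR /=.
  by [].
move=> d; rewrite inE => /predU1P[->|ds]; last first.
  by rewrite split_dot su ?sxy ?mulr0 ?subr0 //; apply: sub_lspan.
have -> : e = u + e' by rewrite def_u subrK.
rewrite split_dot !linearDl /= (sxy e') // (su e') // !addr0.
have [u0|u0] := eqVneq (dot u u) 0.
  by rewrite u0 (dot_self_eq0 u0) linear0l mulr0 subr0.
rewrite /t rmorphM fmorphV /= -!(dotC dot).
by rewrite mulfVK ?subrr.
Qed.

(** The vector z with f z the projection of y on the range of f has the
    defining property of the adjoint, so that the adjoint takes a genuine value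
    here. *)
Lemma adjoint_eq0P f y : (forall x, `|f x| = `|x|) ->
  adjoint dot f y = 0 <-> forall x, dot (f x) y = 0.
Proof.
move=> f_iso; have [z fz] := isometry_range_split hilbertH y f_iso.
have adjz : [set w | forall x, dot (f x) y = dot x w] z.
  move=> x /=; rewrite -(isometry_dot_of_norm hilbertH f_iso x z).
  by rewrite -[y in LHS](subrK (f z)) linearDr /= fz add0r.
have adjE : forall x, dot (f x) y = dot x (adjoint dot f y) :=
  getPex (ex_intro _ z adjz).
split=> [adj0 x|fy]; first by rewrite adjE adj0 linear0r.
by apply: (@dot_self_eq0 _ _ dot); rewrite -adjE.
Qed.

(** The Wold decomposition. The orthogonal complement of the range of f is the
    wandering subspace, and a vector orthogonal to its images under all powers
    of f lies in the range of f, say as f y, where y again has this property.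
    Iterating, it lies in the ranges of all powers, whose intersection is zero.
*)
Lemma wandering_dense f D : is_shift f -> is_subspace D ->
    (forall x, D x -> D (f x)) ->
    (forall e, (forall x, dot (f x) e = 0) -> D e) ->
  dense D.
Proof.
move=> [f_iso f_pure] Dsub fD eD.
suff clD x : closure D x.
  move=> O [x Ox] Oopen; have := clD x O (open_nbhs_nbhs (conj Oopen Ox)).
  by case=> d [Dd Od]; exists d.
have [z Dz xz] :=
  orthogonal_projection (f := idfun) hilbertH x (fun=> erefl) Dsub.
suff : (x - z) \in [set 0] by rewrite inE /= => /subr0_eq ->.
rewrite -f_pure inE => k _.
have : forall m e, (forall x, dot (f x) e = 0) -> dot (iter m f e) (x - z) = 0.
  move=> m e /eD De; apply: xz; elim: m => //= m; exact: fD.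
elim: k (x - z) => [|k IHk] w w_orth; first by exists w.
have [y fy] := isometry_range_split hilbertH w f_iso.
have wE : w = f y.
  apply/subr0_eq; apply: (@dot_self_eq0 _ _ dot).
  by rewrite [dot _ (_ - _)]linearBr /= (w_orth 0%N) // (dot_eq0C (fy y)) subrr.
have [m e fe|v _ vy] := IHk y.
  by rewrite -(isometry_dot_of_norm hilbertH f_iso) -wE; apply: (w_orth m.+1).
by exists v; rewrite //= wE -vy.
Qed.

End Orthogonality.

(** * Polynomials in commuting operators *)

Section PolynomialCalculus.
Context {R : realType} {H : completeNormedModType R[i]} {n : nat}.
Context (V : 'I_n -> {linear H -> H}) (commV : commuting V).
Local Notation A := {mpoly R[i][n]}.
Implicit Types (p q : A) (m : multinom n) (h : H).

(** A sum over one index set for all polynomials of degree below D; it makes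
    the dependence on p visibly linear. *)
Lemma mpoly_opE D p h : (mmeasure mdeg p <= D)%N ->
  mpoly_op V p h = \sum_(m : bmultinom n D) mcoeff m p *: monomial_op V m h.
Proof.
move=> pD; pose I : subFinType _ := bmultinom n D.
rewrite /mpoly_op (big_mksub I) ?msupp_uniq //=; last first.
  by move=> m /msize_mdeg_lt /leq_trans; apply.
by rewrite big_rmcond // => m /memN_msupp_eq0 ->; rewrite scale0r.
Qed.

Lemma mpoly_opD p q h : mpoly_op V (p + q) h = mpoly_op V p h + mpoly_op V q h.
Proof.
pose D := maxn (mmeasure mdeg (p + q))
               (maxn (mmeasure mdeg p) (mmeasure mdeg q)).
rewrite !(@mpoly_opE D) ?leq_max ?leqnn ?orbT // -big_split.
by apply: eq_bigr => m _; rewrite mcoeffD scalerDl.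
Qed.

Lemma mpoly_opZ a p h : mpoly_op V (a *: p) h = a *: mpoly_op V p h.
Proof.
rewrite (@mpoly_opE (mmeasure mdeg p)) ?msizeZ_le // (mpoly_opE _ (leqnn _)).
by rewrite scaler_sumr; apply: eq_bigr => m _; rewrite mcoeffZ scalerA.
Qed.

Lemma mpoly_op0 h : mpoly_op V 0 h = 0.
Proof. by rewrite -(scale0r (0 : A)) mpoly_opZ scale0r. Qed.

Lemma mpoly_op_mpolyX m h : mpoly_op V (mpolyX _ m) h = monomial_op V m h.
Proof. by rewrite /mpoly_op msuppX big_seq1 mcoeffX eqxx scale1r. Qed.

Lemma monomial_op_linear m a u v :
  monomial_op V m (a *: u + v) = a *: monomial_op V m u + monomial_op V m v.
Proof.
rewrite /monomial_op; elim: (index_enum _) => [|i r IHr].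
  by rewrite !big_nil.
rewrite !big_cons /= IHr; elim: (m i) => //= k ->.
by rewrite linearP.
Qed.

Lemma mpoly_op_linear p a u v :
  mpoly_op V p (a *: u + v) = a *: mpoly_op V p u + mpoly_op V p v.
Proof.
rewrite /mpoly_op scaler_sumr -big_split; apply: eq_bigr => m _ /=.
by rewrite monomial_op_linear scalerDr scalerA mulrC -scalerA.
Qed.

Lemma mpoly_op_sum p (I : Type) (r : seq I) (c : I -> R[i]) (F : I -> H) :
  mpoly_op V p (\sum_(j <- r) c j *: F j) =
  \sum_(j <- r) c j *: mpoly_op V p (F j).
Proof.
elim: r => [|j r IHr]; last by rewrite !big_cons mpoly_op_linear IHr.
rewrite !big_nil -[0 in LHS](addNr 0) -scaleN1r mpoly_op_linear.
by rewrite scaleN1r addNr.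
Qed.

Lemma monomial_opD m1 m2 h :
  monomial_op V (mnm_add m1 m2) h = monomial_op V m1 (monomial_op V m2 h).
Proof.
have comm i k r g : let F := \big[(fun g h : H -> H => g \o h)/id]_(j <- r)
    iter (m1 j) (V j) in iter k (V i) (F g) = F (iter k (V i) g).
  elim: k => //= k ->; elim: r => [|j r IHr]; first by rewrite big_nil.
  by rewrite !big_cons /= -IHr; elim: (m1 j) => //= l <-; rewrite commV.
rewrite /monomial_op; elim: (index_enum _) h => [|i r IHr] h.
  by rewrite !big_nil.
by rewrite !big_cons /= IHr mnmDE iterD comm.
Qed.

(** By linearity in both factors this reduces to monomials. *)
Lemma mpoly_opM p q h : mpoly_op V (p * q) h = mpoly_op V p (mpoly_op V q h).
Proof.
have XM m1 : mpoly_op V (mpolyX _ m1 * q) h = monomial_op V m1 (mpoly_op V q h).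
  rewrite [q in LHS]mpolyE mulr_sumr -(mpoly_op_mpolyX m1).
  rewrite [mpoly_op V q h]/mpoly_op mpoly_op_sum.
  elim: (msupp q) => [|m r IHr]; first by rewrite !big_nil mpoly_op0.
  rewrite !big_cons mpoly_opD IHr; congr (_ + _).
  by rewrite -scalerAr mpoly_opZ -mpolyXD !mpoly_op_mpolyX monomial_opD.
rewrite [p in LHS]mpolyE mulr_suml [RHS]/mpoly_op.
elim: (msupp p) => [|m r IHr]; first by rewrite !big_nil mpoly_op0.
by rewrite !big_cons mpoly_opD IHr -scalerAl mpoly_opZ XM.
Qed.

Lemma mpoly_opXU i h : mpoly_op V 'x_i h = V i h.
Proof.
rewrite mpoly_op_mpolyX /monomial_op.
suff big_iter r : uniq r -> (\big[(fun g h : H -> H => g \o h)/id]_(j <- r)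
    iter (mnm1 i j) (V j)) h = if i \in r then V i h else h.
  by rewrite big_iter ?index_enum_uniq ?mem_index_enum.
elim: r => [|j r IHr] /=; first by rewrite big_nil.
case/andP=> jr /IHr {}IHr; rewrite big_cons /= IHr inE mnm1E.
by have [->|] := eqVneq i j; rewrite // (negPf jr).
Qed.

Lemma mpoly_op1 h : mpoly_op V 1 h = h.
Proof.
rewrite -mpolyX0 mpoly_op_mpolyX /monomial_op.
by elim/big_ind: _ => // [f g fh gh|i _]; rewrite /= ?gh ?fh ?mnm0E.
Qed.

Lemma mpoly_op_commute p i h : mpoly_op V p (V i h) = V i (mpoly_op V p h).
Proof. by rewrite -!mpoly_opXU -!mpoly_opM mulrC. Qed.

(** The annihilator of the quotient of H by the range of V i, seen as a module
    over the polynomial ring. *)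
Definition range_ideal i : set A :=
  [set p | forall h, range (V i) (mpoly_op V p h)].

Lemma Ann_ideal : is_ideal (Ann V).
Proof.
split=> [h|p q Vp Vq h|a p Vp h]; first exact: mpoly_op0.
  by rewrite mpoly_opD Vp Vq addr0.
by rewrite mulrC mpoly_opM Vp.
Qed.

Lemma range_ideal_ideal i : is_ideal (range_ideal i).
Proof.
split=> [h|p q Jp Jq h|a p Jp h].
- by rewrite mpoly_op0; exists 0; rewrite ?linear0.
- have [[u _ pu] [v _ qv]] := (Jp h, Jq h); rewrite mpoly_opD -pu -qv.
  by exists (u + v); rewrite ?linearD.
have [u _ pu] := Jp h; rewrite mpoly_opM -pu mpoly_op_commute.
by exists (mpoly_op V a u).
Qed.


(** Write f = x q + r(y), where x acts as V i and y as V j. If r is nonzero,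
    then r(V j) = - V i q(V i, V j) has its values in the range of V i.
    Otherwise V i is injective, so q is a relation too, of lower degree. *)
Lemma annihilator_to_range_ideal i j (f : {poly {poly R[i]}}) :
    (forall x, V i x = 0 -> x = 0) -> f != 0 -> Ann V (bieval 'x_i 'x_j f) ->
  exists2 r, r != 0 & range_ideal i (horner_alg 'x_j r).
Proof.
move=> Vi_inj; elim/poly_ind: f => [|f r IHf]; first by rewrite eqxx.
rewrite rmorphD rmorphM /= bievalX bievalC => f0 Vf.
have [r0|r0] := eqVneq r 0; last first.
  exists r => // h; exists (- mpoly_op V (bieval 'x_i 'x_j f) h) => //.
  rewrite linearN /= -mpoly_op_commute -mpoly_opXU -mpoly_opM.
  by have /eqP := Vf h; rewrite mpoly_opD addrC addr_eq0 => /eqP.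
apply: IHf => [|h]; first by apply: contraNneq f0 => ->; rewrite mul0r r0 addr0.
apply: Vi_inj; rewrite -mpoly_op_commute -mpoly_opXU -mpoly_opM.
by have := Vf h; rewrite r0 rmorph0 addr0.
Qed.

End PolynomialCalculus.

(** * Cyclic sets and multiplicities *)

Lemma uncountable_complex (R : realType) : ~ countable [set: R[i]].
Proof.
case/countable_injP => g g_inj.
suff /countable_lebesgue_measure0 : countable [set: R].
  by have := @lebesgue_measure_itv R `]-oo, +oo[; rewrite set_itvE => ->.
apply/countable_injP; exists (fun x : R => g x%:C%C) => x y _ _.
by move/(g_inj _ _ (mem_set I) (mem_set I)) => [].
Qed.

Section MainTheorem.
Context {R : realType} {H : completeNormedModType R[i]}.
Context (dot : {dot H for Num.conj}) (hilbertH : hilbert_dot dot).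
Context {n : nat} (V : 'I_n -> {linear H -> H}).
Context (isoV : forall i x, `|V i x| = `|x|) (commV : commuting V).

(** Let P be the projection on the kernel of the adjoint of V i. Modulo the
    range of V i, a vector p(V) h with h in S is a combination of the finitely
    many vectors V^m h with m of degree below D, so P maps the dense span of
    the p(V) h into the span of the finite family L of the P (V^m h). A vector
    of the kernel orthogonal to L is orthogonal to a dense set, hence zero. *)
Lemma cyclic_finite_multiplicity i D (S : set H) :
    finite_set S -> cyclic_set V S ->
    (forall p, exists2 q, (mmeasure mdeg q <= D)%N & range_ideal V i (p - q)) ->
  finite_multiplicity dot (V i).
Proof.
move=> /finite_seqP [s ->] Vs redD.
have /choice [z zP] x := isometry_range_split hilbertH x (isoV i).
pose P x := x - V i (z x).
pose L := [seq P (monomial_op V m h) |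
            m : bmultinom n D <- enum {: bmultinom n D}, h : H <- s].
exists [set` L]; split; first exact: finite_seq.
apply/seteqP; split=> y; last first.
  move: y; apply: lspan_min.
    split=> [|a u v]; rewrite /= !(adjoint_eq0P hilbertH _ (isoV i)).
      by move=> x; rewrite linear0r.
    by move=> u0 v0 x; rewrite linearDr linearZr_LR /= u0 v0 mulr0 addr0.
  move=> _ /allpairsP [[m h] [_ _ ->]].
  by rewrite /= (adjoint_eq0P hilbertH _ (isoV i)); apply: zP.
rewrite /= (adjoint_eq0P hilbertH _ (isoV i)) => Vy.
have [w Lw wy] := finite_span_projection dot L y.
have Vw x : dot (V i x) w = 0.
  move: w Lw {wy}; apply: lspan_min; first exact: orthogonal_subspace_r.
  by move=> _ /allpairsP [[m h] [_ _ ->]]; apply: zP.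
have Vyw x : dot (V i x) (y - w) = 0 by rewrite linearBr /= Vy Vw subrr.
suff /subr0_eq -> : y - w = 0 by [].
apply: (dense_orthogonal_eq0 hilbertH Vs).
apply: lspan_min; first exact: orthogonal_subspace.
move=> _ [p [h [sh ->]]] /=; have [q qD pq] := redD p.
have [u _ pqu] := pq h.
rewrite -(subrK q p) mpoly_opD -pqu linearDl /= Vyw add0r.
rewrite (mpoly_opE _ _ qD).
apply: (subspace_sum (D := [set x | dot x (y - w) = 0])).
  exact: orthogonal_subspace.
move=> m; apply: subspaceZ; first exact: orthogonal_subspace.
rewrite /= -[monomial_op _ _ _](subrK (V i (z (monomial_op V m h)))).
rewrite linearDl /= Vyw addr0.
by apply: wy; apply/allpairsP; exists (m, h); split; rewrite ?mem_enum.
Qed.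

End MainTheorem.

Theorem theorem6p2 (R : realType) (H : completeNormedModType R[i])
    (dot : {dot H for Num.conj}) (hilbertH : hilbert_dot dot)
    (n : nat) (V : 'I_n -> {linear H -> H})
    (shiftV : forall i, is_shift (V i)) (commV : commuting V)
    (dimV : variety_dim (zero_set (Ann V)) 1) :
  [<-> exists S : set H, finite_set S /\ cyclic_set V S;
       forall i, finite_multiplicity dot (V i);
       exists i, finite_multiplicity dot (V i)].
Proof.
have isoV i x : `|V i x| = `|x| by have [] := shiftV i.
have V_inj i x : V i x = 0 -> x = 0.
  by move=> Vx0; apply/eqP; rewrite -normr_eq0 -(isoV i) Vx0 normr0.
have [[Y [Yirr Ylt]] dim_le] := dimV.
tfae.
- move=> [S [Sfin Scyc]] i.
  have [|D redD] := algebraic_generators_bounded (range_ideal_ideal commV i).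
    move=> j; apply: contrapT => notalg.
    have [|Z /dim_le //] := independent_pair_chain (@uncountable_complex R)
      (i := i) (j := j) (Ann_ideal commV).
    move=> f f0 Vf; apply: notalg.
    exact: (annihilator_to_range_ideal commV (V_inj i) f0 Vf).
  exact: (cyclic_finite_multiplicity hilbertH isoV Sfin Scyc redD).
(* There is an index i: without variables the affine space is a point, which
   has no chain of length one. *)
- move=> finV; have [n0|n_gt0] := posnP n; last first.
    by exists (Ordinal n_gt0); apply: finV.
  have [_ []] := Ylt ord0 ord_max isT.
  have [_ [[z Yz] _] _] := Yirr ord0.
  move=> w _; suff -> : w = z by [].
  by apply/funext => i; have := ltn_ord i; rewrite [X in (_ < X)%N]n0.
move=> [i [E [Efin VE]]]; exists E; split=> //.
have Esub p h : E h -> lspan [set v | exists p h, E h /\ v = mpoly_op V p h]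
    (mpoly_op V p h).
  by move=> Eh; apply: sub_lspan; exists p, h.
apply: (wandering_dense hilbertH (shiftV i)).
- exact: lspan_subspace.
- move=> x [k [c [e [Ee ->]]]]; rewrite linear_sum.
  apply: subspace_sum => [|l]; first exact: lspan_subspace.
  rewrite linearZ; apply: subspaceZ; first exact: lspan_subspace.
  have [p [h [Eh ->]]] := Ee l.
  by rewrite -mpoly_opXU // -mpoly_opM //; apply: Esub.
- move=> e /(adjoint_eq0P hilbertH _ (isoV i)) Ve.
  have : lspan E e by rewrite -VE.
  apply: lspan_min; first exact: lspan_subspace.
  by move=> h Eh; rewrite -(mpoly_op1 V h); apply: Esub.
Qed.
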